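(* Let $n,m$ be positive integers, let $F$ be a field of characteristic zero, let $X$ be an $n$-element set, and let $G$ be a subgroup of $\mathrm{Sym}(X)$. Let $\Delta:G\to F$ be any function. Then, in $F[w_1,\ldots,w_m]$, \[ \sum_{\boldsymbol{k}\in\mathcal{P}_m([n])}\left(\sum_{\boldsymbol{\alpha}\in\boldsymbol{k}(X)}\ \sum_{\sigma\in\mathrm{Sym}(\boldsymbol{\alpha})\cap G}\Delta(\sigma)\right)\boldsymbol{w}^{(\boldsymbol{k})}=\sum_{\sigma\in G}\Delta(\sigma)\,Z(\sigma,\tilde{\boldsymbol{w}}). \]
   Context: $\mathcal{P}_m([n])$ is the set of tuples $\boldsymbol{k}=(k_1,\ldots,k_m)$ of nonnegative integers with $\sum_i k_i=n$, and $\boldsymbol{w}^{(\boldsymbol{k})}=w_1^{k_1}\cdots w_m^{k_m}$. For $\boldsymbol{k}\in\mathcal{P}_m([n])$, $\boldsymbol{k}(X)$ is the set of tuples $\boldsymbol{\alpha}=(A_1,\ldots,A_m)$ of pairwise disjoint subsets of $X$ with $|A_i|=k_i$ for all $i$ (so they partition $X$). For such $\boldsymbol{\alpha}$, $\mathrm{Sym}(\boldsymbol{\alpha})=\mathrm{Sym}(A_1)\times\cdots\times\mathrm{Sym}(A_m)$, viewed as a subgroup of $\mathrm{Sym}(X)$. For $\sigma\in\mathrm{Sym}(X)$, $c_i(\sigma)$ is the number of cycles of length $i$ of $\sigma$, and for $\boldsymbol{t}=(t_1,\ldots,t_n)$, $Z(\sigma,\boldsymbol{t})=t_1^{c_1(\sigma)}\cdots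 t_n^{c_n(\sigma)}$. Finally $\tilde{\boldsymbol{w}}=\left(\sum_{i=1}^m w_i,\sum_{i=1}^m w_i^2,\ldots,\sum_{i=1}^m w_i^n\right)$. *)

(* Defs.v *)
From mathcomp Require Import all_boot all_order all_algebra all_fingroup.
From mathcomp Require Import mpoly.

Set Implicit Arguments.
Unset Strict Implicit.
Unset Printing Implicit Defensive.

Local Open Scope ring_scope.

Section Defs.

Variables (X : finType) (m n : nat).

(* A multi-index k = (k_1, ..., k_m) is a [multinom], as is usual for
   exponents in multinomials; the bound n.+1 on the degree only serves to
   have a finite type, and loses nothing since the total degree is n. *)
Definition compositions : {set 'X_{1..m < n.+1}} :=
  [set k : 'X_{1..m < n.+1} | mdeg k == n].

Definition ordered_partitions (k : 'X_{1..m}) : {set {ffun 'I_m -> {set X}}} :=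
  [set A : {ffun 'I_m -> {set X}} |
    [forall i, forall j, (i != j) ==> [disjoint A i & A j]]
    && [forall i, #|A i| == k i]].

(* [Sym B] is the subgroup of permutations of X fixing every point outside B,
   so this product of subgroups of Sym(X) is the image of
   Sym(A_1) x ... x Sym(A_m); see [young_subgroup_dprod]. *)
Definition young_subgroup (A : 'I_m -> {set X}) : {set {perm X}} :=
  (\prod_(i < m) Sym (A i))%g.

(* [porbits s] contains the singletons of fixed points, so fixed points are
   counted as cycles of length 1. *)
Definition ncycles (i : nat) (s : {perm X}) : nat :=
  #|[set C in porbits s | #|C| == i]|.

(* The index i : 'I_n stands for i + 1 in 1..n. *)
Definition cycle_index_monomial (R : comNzRingType) (s : {perm X})
    (t : 'I_n -> R) : R :=
  \prod_(i < n) t i ^+ ncycles i.+1 s.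

Definition power_sums (R : comNzRingType) (i : 'I_n) : {mpoly R[m]} :=
  \sum_(j < m) 'X_j ^+ i.+1.

End Defs.

Arguments ordered_partitions X [m] k.
Arguments power_sums m n R i : clear implicits.

Lemma Sym_setC_subset_cent (X : finType) (B : {set X}) :
  (Sym (~: B) \subset 'C(Sym B) :\: (Sym B)^#)%g.
Proof.
apply/subsetP=> s; rewrite inE => sCB; rewrite !inE; apply/andP; split.
  rewrite negb_and negbK; case: eqP => //= s_neq1; apply/negP=> sB.
  apply: s_neq1; apply/permP=> x; rewrite perm1.
  have [xB|xNB] := boolP (x \in B); last exact: (out_perm sB).
  by apply: (out_perm sCB); rewrite inE xB.
apply/centP=> u; rewrite inE => uB; apply: perm_onC sCB uB _.
by rewrite disjoint_sym -setI_eq0 setICr.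
Qed.

Lemma young_subgroup_dprod (X : finType) (m : nat) (A : 'I_m -> {set X}) :
  (forall i j, i != j -> [disjoint A i & A j]) ->
  (\big[dprod/1]_(i < m) Sym (A i))%g = young_subgroup A.
Proof.
move=> disA; pose H i := Sym_group (A i).
suff /eqP dxH : (\big[dprod/1]_(i < m) H i == (\prod_(i < m) H i)%G)%g.
  by rewrite [LHS]dxH /young_subgroup (bigdprodW dxH).
apply/bigdprodYP=> i _; apply: subset_trans (Sym_setC_subset_cent (A i)).
rewrite bigprodGE gen_subG; apply/bigcupsP=> j /= j_neq_i.
apply/subsetP=> s; rewrite !inE => sAj; apply: subset_trans sAj _.
by rewrite subsets_disjoint setCK disA.
Qed.

(* Main.v *)
Require Import Defs.
From mathcomp Require Import all_boot all_algebra all_fingroup mpoly.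

Set Implicit Arguments.
Unset Strict Implicit.
Unset Printing Implicit Defensive.

(** Sending a colouring f : X -> 'I_m to the tuple of its fibres is a bijection
    onto the ordered partitions of X into m parts, and a permutation lies in
    the Young subgroup of the fibres iff f is constant on its cycles.  Both
    sides are therefore the sum of [Delta s *: \prod_x 'X_(f x)] over the pairs
    (f, s) such that f is constant on the cycles of s: on the right this comes
    from expanding the product, over the cycles of s, of the power sums. *)

Import GRing.Theory.

Local Open Scope ring_scope.

Definition fibers {X : finType} {m : nat} (f : {ffun X -> 'I_m}) :
  {ffun 'I_m -> {set X}} := [ffun i => [set x | f x == i]].

Definition constant_on_cycles {X : finType} {T : eqType} (f : X -> T)
  (s : {perm X}) : bool := [forall x, f (s x) == f x].

Lemma mem_fibers (X : finType) m (f : {ffun X -> 'I_m}) i x :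
  (x \in fibers f i) = (f x == i).
Proof. by rewrite ffunE inE. Qed.

Lemma fibers_inj (X : finType) m : injective (@fibers X m).
Proof.
move=> f g fg; apply/ffunP => x.
by have := mem_fibers f (f x) x; rewrite fg mem_fibers eqxx => /eqP.
Qed.

Lemma sum_card_fibers (X : finType) m (f : {ffun X -> 'I_m}) :
  (\sum_i #|fibers f i| = #|X|)%N.
Proof.
rewrite -sum1_card (partition_big f predT) //=.
by apply: eq_bigr => i _; rewrite sum1dep_card ffunE.
Qed.

Definition fiber_degrees {X : finType} {m : nat} (f : {ffun X -> 'I_m}) :
  'X_{1..m} := [multinom #|fibers f i| | i < m].

Lemma mdeg_fiber_degrees (X : finType) m (f : {ffun X -> 'I_m}) :
  mdeg (fiber_degrees f) = #|X|.
Proof.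
by rewrite mdegE -(sum_card_fibers f); apply: eq_bigr => i _; rewrite mnmE.
Qed.

Lemma fibers_ordered_partition (X : finType) m (f : {ffun X -> 'I_m}) k :
  (fibers f \in ordered_partitions X k) = (fiber_degrees f == k).
Proof.
rewrite inE; set disj := [forall i, _].
have -> : disj.
  apply/forallP => i; apply/forallP => j; apply/implyP => neq_ij.
  rewrite -setI_eq0; apply/eqP/setP => x; rewrite inE !mem_fibers inE.
  by apply/negP => /andP[/eqP-> /eqP ij]; rewrite ij eqxx in neq_ij.
apply/forallP/eqP => [fk|<- i]; last by rewrite mnmE.
by apply/mnmP => i; rewrite mnmE; apply/eqP.
Qed.

(* Disjointness and the cardinals summing to #|X| force the parts to cover X. *)
Lemma ordered_partition_fibers (X : finType) m k
    (A : {ffun 'I_m -> {set X}}) :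
  mdeg k = #|X| -> A \in ordered_partitions X k -> exists f, fibers f = A.
Proof.
move=> degk; rewrite inE => /andP[/forallP disA /forallP cardA].
have memA x i j : x \in A i -> x \in A j -> i = j.
  move=> xi xj; apply/eqP; apply: contraLR xj => neq_ij.
  by have /forallP/(_ j)/implyP/(_ neq_ij)/disjointFr-> := disA i.
have cardU : #|\bigcup_i A i| = #|X|.
  rewrite -degk mdegE -sum1_card.
  rewrite partition_disjoint_bigcup; last first.
    by move=> i j neq_ij; have /forallP/(_ j)/implyP/(_ neq_ij) := disA i.
  by apply: eq_bigr => i _; rewrite sum1_card; apply/eqP.
have coverA x : exists i, x \in A i.
  have /setP/(_ x) : \bigcup_i A i = setT.
    by apply/eqP; rewrite eqEcard subsetT cardsT cardU leqnn.
  by rewrite inE => /bigcupP[i _ xi]; exists i.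
exists [ffun x => xchoose (coverA x)]; apply/ffunP => i; apply/setP => x.
rewrite mem_fibers ffunE; have xA := xchooseP (coverA x).
by apply/eqP/idP => [<-//|xi]; apply: memA xA xi.
Qed.

(** Each [u i] moves only points of the fibre over [i] and keeps them there, so the factor of index
    [f x] is the only one that can move [x]. An arbitrary duplicate-free [r] makes induction
    possible. *)
Lemma prod_Sym_fibers (X : finType) m (f : {ffun X -> 'I_m})
    (u : 'I_m -> {perm X}) (r : seq 'I_m) x :
  (forall i, u i \in Sym (fibers f i)) -> uniq r ->
  (\prod_(i <- r) u i)%g x = if f x \in r then u (f x) x else x.
Proof.
move=> uS; have uon i : perm_on (fibers f i) (u i) by have := uS i; rewrite inE.
elim: r x => [|i r IHr] x /=; first by rewrite big_nil perm1.
case/andP=> i_r uniq_r; rewrite big_cons permM IHr // inE.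
have [fxi|fxi] := eqVneq (f x) i; last first.
  by rewrite (out_perm (uon i)) // mem_fibers.
(* [u i] acts first and its value stays over [i]; since [i] does not occur in the tail, the
   remaining factors fix that value. *)
have : u i x \in fibers f i by rewrite perm_closed // mem_fibers fxi.
by rewrite mem_fibers /= fxi => /eqP ->; rewrite (negPf i_r).
Qed.

(** The permutations preserving [f] form a group that contains every factor [Sym (fibers f i)],
    hence their product. Conversely, such a permutation is the product of its restrictions to the
    fibres. *)
Lemma mem_young_subgroup_fibers (X : finType) m (f : {ffun X -> 'I_m}) s :
  (s \in young_subgroup (fibers f)) = constant_on_cycles f s.
Proof.
have stab_group : group_set [set t | constant_on_cycles f t].
  apply/group_setP; split; first by rewrite inE; apply/forallP=> x; rewrite perm1.
  move=> t u; rewrite !inE => /forallP ft /forallP fu; apply/forallP => x.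
  by rewrite permM (eqP (fu _)).
apply/idP/idP => [|/forallP fs].
  suff /subsetP/(_ s) : young_subgroup (fibers f) \subset group stab_group.
    by move=> sub /sub; rewrite inE.
  rewrite /young_subgroup; elim/big_ind: _ => [|U V HU HV|i _].
  - exact: sub1G.
  - exact: mul_subG.
  apply/subsetP => t; rewrite !inE => t_on; apply/forallP => x.
  have := perm_closed x t_on; rewrite !mem_fibers.
  have [-> /eqP->//|fxi _] := eqVneq (f x) i.
  by rewrite (out_perm t_on) // mem_fibers.
(* Invariance of the fibres is what makes [restr_perm] agree with [s] on them. *)
have sN i : s \in ('N(fibers f i | 'P))%g.
  apply/astabsP => x; rewrite /= apermE !mem_fibers.
  by rewrite (eqP (fs x)).
have uS i : restr_perm (fibers f i) s \in Sym (fibers f i).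
  by rewrite inE restr_perm_on.
have -> : s = (\prod_(i < m) restr_perm (fibers f i) s)%g.
  apply/permP => x; rewrite (prod_Sym_fibers (f := f)) ?index_enum_uniq //.
  by rewrite mem_index_enum restr_permE ?mem_fibers.
by apply: mem_prodg => i _.
Qed.

Lemma mpolyX_fiber_degrees (R : comNzRingType) (X : finType) m
    (f : {ffun X -> 'I_m}) :
  'X_[fiber_degrees f] = \prod_x 'X_(f x) :> {mpoly R[m]}.
Proof.
rewrite mpolyXE_id (partition_big f predT) //=; apply: eq_bigr => i _.
rewrite mnmE (eq_bigr (fun=> 'X_i)); last by move=> x /eqP->.
by rewrite prodr_const ffunE cardsE.
Qed.

(** Grouping the cycles by length turns the product over cycles into the monomial. Taking [t] on
    [nat] allows evaluation at [#|C|] itself, without the shift of ordinals. *)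
Lemma cycle_index_monomial_porbits (R : comNzRingType) (X : finType)
    (s : {perm X}) (t : nat -> R) :
  cycle_index_monomial s (fun i : 'I_#|X| => t i.+1)
  = \prod_(C in porbits s) t #|C|.
Proof.
(* For empty [X] both products are empty. Otherwise a set [C] gets the index [#|C|.-1], which is
   below [#|X|] even when [C] is empty, so the grouping map is total on [{set X}]. *)
case: (posnP #|X|) => [X0|X_gt0].
  rewrite /cycle_index_monomial !big1 // => [C /imsetP[x]|[i]].
    by have := card0_eq X0 x.
  by move=> i_lt; exfalso; rewrite X0 in i_lt.
have predK (C : {set X}) : C \in porbits s -> (#|C|.-1.+1 = #|C|)%N.
  case/imsetP=> x _ ->; rewrite prednK //; apply/card_gt0P.
  by exists x; apply: porbit_id.
have ltX (C : {set X}) : (#|C|.-1 < #|X|)%N.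
  by rewrite -(prednK X_gt0) ltnS -!subn1 leq_sub2r // max_card.
rewrite (partition_big (fun C => Ordinal (ltX C)) predT) //=.
apply: eq_bigr => i _.
rewrite (eq_bigl (mem [set C in porbits s | #|C| == i.+1])); last first.
  move=> C; rewrite [RHS]/= [RHS]inE; case Cs: (C \in porbits s) => //=.
  by rewrite -val_eqE /= -eqSS predK.
rewrite (eq_bigr (fun=> t i.+1)); last first.
  by move=> C; rewrite /= [X in is_true X]inE => /andP[_ /eqP->].
by rewrite prodr_const.
Qed.

Lemma constant_on_cycles_porbit (X : finType) (T : eqType) (f : X -> T) s x y :
  constant_on_cycles f s -> y \in porbit s x -> f y = f x.
Proof.
move=> /forallP fs /porbitP[i ->]; elim: i => [|i IHi]; first by rewrite perm1.
by rewrite expgSr permM (eqP (fs _)).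
Qed.

(** Expanding the product picks one index per cycle, which amounts to a colouring constant on
    cycles; a cycle [C] of colour [j] contributes one factor [v j] for each of its points. *)
Lemma prod_porbits_sum (R : comNzRingType) (X : finType) m (s : {perm X})
    (v : 'I_m -> R) : (0 < m)%N ->
  \prod_(C in porbits s) \sum_(j < m) v j ^+ #|C|
  = \sum_(f : {ffun X -> 'I_m} | constant_on_cycles f s) \prod_x v (f x).
Proof.
case: m v => // m v _.
(* The choices become functions on all of [{set X}] with value [ord0] off the cycles; [restr] below
   takes the same default, so that it inverts [colour]. *)
rewrite (big_distr_big ord0) /=.
pose colour (g : {ffun {set X} -> 'I_m.+1}) := [ffun x => g (porbit s x)].
pose restr (f : {ffun X -> 'I_m.+1}) : {ffun {set X} -> 'I_m.+1} :=
  [ffun C => if C \in porbits s then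
     if [pick x in C] is Some x then f x else ord0 else ord0].
have restrE (f : {ffun X -> _}) x : constant_on_cycles f s -> restr f (porbit s x) = f x.
  move=> fs; rewrite ffunE imset_f //; case: pickP => [y yx|/(_ x)].
    exact: constant_on_cycles_porbit fs yx.
  by rewrite porbit_id.
have colour_const g : constant_on_cycles (colour g) s.
  by apply/forallP=> x; rewrite !ffunE -(porbit_perm s 1 x) expg1.
rewrite [RHS](reindex_onto colour restr) /=; last first.
  by move=> f fs; apply/ffunP => x; rewrite ffunE restrE.
apply: eq_big => [g|g _].
  (* The functions fixed by [colour] followed by [restr] are exactly those supported on the
     cycles. *)
  rewrite colour_const /=; apply/pfamilyP/eqP => [[gs _]|<-].
    apply/ffunP => C; have [/imsetP[x _ ->]|Cs] := boolP (C \in porbits s).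
      by rewrite restrE // ffunE.
    rewrite ffunE (negPf Cs); apply/esym/eqP.
    by apply: contraNT Cs => gC; apply: (subsetP gs).
  split=> //; apply/subsetP => C; rewrite inE ffunE.
  by case: ifP; rewrite ?eqxx.
rewrite [RHS](partition_big_imset (porbit s)) /=.
apply: eq_bigr => C /imsetP[y _ ->].
rewrite (eq_bigr (fun=> v (g (porbit s y)))); last first.
  by move=> x /eqP xy; rewrite ffunE xy.
rewrite prodr_const; congr (_ ^+ _); apply: eq_card => x.
by rewrite porbit_sym -eq_porbit_mem.
Qed.

Theorem theorem2p1 (n m : nat) (n_gt0 : (0 < n)%N) (m_gt0 : (0 < m)%N)
    (F : fieldType) (charF : [pchar F] =i pred0)
    (X : finType) (cardX : #|X| = n)
    (G : {group {perm X}}) (Delta : {perm X} -> F) :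
  \sum_(k in compositions m n)
     (\sum_(A in ordered_partitions X k)
        \sum_(s in young_subgroup A :&: G) Delta s) *: 'X_[k]
  = \sum_(s in G)
      Delta s *: cycle_index_monomial s (power_sums m n F)
  :> {mpoly F[m]}.
Proof.
subst n.
have degP (f : {ffun X -> 'I_m}) : (mdeg (fiber_degrees f) < #|X|.+1)%N.
  by rewrite mdeg_fiber_degrees.
transitivity (\sum_(f : {ffun X -> 'I_m})
    \sum_(s in G | constant_on_cycles f s) Delta s *: \prod_x 'X_(f x)
    : {mpoly F[m]}).
  (* Colourings are grouped by their fibre sizes, which sum to [#|X|] and thus give an element of
     [compositions]. *)
  rewrite [RHS](partition_big (fun f => BMultinom (degP f))
                  (mem (compositions m #|X|))) /=; last first.
    by move=> f _; rewrite inE /= mdeg_fiber_degrees.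
  apply: eq_bigr => k; rewrite inE => /eqP degk.
  have -> : ordered_partitions X k
            = fibers @: [set f : {ffun X -> 'I_m} | fiber_degrees f == k].
    apply/setP => A; apply/idP/imsetP => [Ak|[f fk ->]].
      have [f fA] := ordered_partition_fibers degk Ak.
      by exists f => //; rewrite inE -fibers_ordered_partition fA.
    by rewrite fibers_ordered_partition; rewrite inE in fk.
  rewrite big_imset /=; last by move=> f g _ _; apply: fibers_inj.
  rewrite scaler_suml; apply: eq_big => [f|f]; first by rewrite inE -val_eqE.
  rewrite inE => /eqP <-; rewrite scaler_suml mpolyX_fiber_degrees.
  by apply: eq_bigl => s; rewrite inE mem_young_subgroup_fibers andbC.
(* With [s] outermost, the sum over colourings constant on its cycles is the expanded product of
   power sums. *)
rewrite (exchange_big_dep (mem G)) /=; last by move=> f s _ /andP[].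
apply: eq_bigr => s sG; rewrite -scaler_sumr.
congr (_ *: _); rewrite /power_sums.
rewrite (cycle_index_monomial_porbits s (fun i => \sum_(j < m) 'X_j ^+ i)).
rewrite (prod_porbits_sum _ _ m_gt0).
by apply: eq_bigl => f; rewrite sG.
Qed.
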